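(* Let $L$ be a distributive meet semi-lattice and let $D(L)$ be its distributive envelope, with $\sigma: L \to D(L)$, $\sigma(a)=\{x\in \mathrm{Pr}(L): a\in x\}$. Then: (1) A subset $I \subseteq L$ is a Frink ideal of $L$ if and only if there is a (lattice) ideal $J$ of $D(L)$ such that $I = \sigma^{-1}(J)$. (2) A subset $I \subseteq L$ is a prime Frink ideal of $L$ if and only if there is a prime (lattice) ideal $J$ of $D(L)$ such that $I = \sigma^{-1}(J)$.
   Context: A meet semi-lattice is a poset in which any two elements $a,b$ have a greatest lower bound $a\wedge b$. It is distributive if whenever $b_1\wedge b_2\leq a$ there exist $c_1,c_2$ with $b_1\le c_1$, $b_2\le c_2$ and $a=c_1\wedge c_2$. A filter of $L$ is a nonempty upset closed under $\wedge$; it is proper if it is not $L$. A prime filter is a proper filter $F$ such that for all filters $F_1,F_2$ of $L$ with $F_1\cap F_2\subseteq F$ we have $F_1\subseteq F$ or $F_2\subseteq F$. $\mathrm{Pr}(L)$ denotes the set of prime filters of $L$, and $D(L)$ (the distributive envelope of $L$) is the sublattice of the powerset of $\mathrm{Pr}(L)$ generated by $\{\sigma(a):a\in L\}$, i.e. the set of finite unions $\sigma(a_1)\cup\dots\cup\sigma(a_n)$, $n\ge 1$, with $\cap,\cup$. For $a\in L$, ${\uparrow}a=\{b\in L: a\le b\}$. A Frink ideal of $L$ is a nonempty $I\subseteq L$ such that for all $a_1,\dots,a_n\in I$ and $c\in L$, if ${\uparrow}a_1\cap\dots\cap{\uparrow}a_n\subseteq{\uparrow}c$ then $c\in I$. A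 Frink ideal $I$ is prime if $I\neq L$ and $a\wedge b\in I$ implies $a\in I$ or $b\in I$. Ideals and prime ideals of the lattice $D(L)$ are meant in the usual lattice-theoretic sense. *)

(* Defs.v *)
From HB Require Import structures.
From mathcomp Require Import all_boot all_order.
From mathcomp Require Import boolp classical_sets.

Set Implicit Arguments.
Unset Strict Implicit.
Unset Printing Implicit Defensive.

Import Order.TTheory.
Local Open Scope classical_set_scope.

Section MeetSemilattice.
Context {d : Order.disp_t} {L : meetSemilatticeType d}.
Implicit Types (a b c : L) (F I : set L).

Definition up a : set L := [set b | (a <= b)%O].

Definition meet_filter F : Prop :=
  [/\ F !=set0,
      forall a b, F a -> (a <= b)%O -> F b
    & forall a b, F a -> F b -> F (a `&` b)%O].

Definition prime_filter F : Prop :=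
  [/\ meet_filter F, F <> setT
    & forall F1 F2, meet_filter F1 -> meet_filter F2 ->
        F1 `&` F2 `<=` F -> F1 `<=` F \/ F2 `<=` F].

Definition frink_ideal I : Prop :=
  I !=set0 /\
  forall (n : nat) (a : 'I_n.+1 -> L) c,
    (forall i, I (a i)) -> \bigcap_i up (a i) `<=` up c -> I c.

Definition prime_frink_ideal I : Prop :=
  [/\ frink_ideal I, I <> setT
    & forall a b, I (a `&` b)%O -> I a \/ I b].

End MeetSemilattice.

Definition distributive_meet_semilattice
    {d : Order.disp_t} (L : meetSemilatticeType d) : Prop :=
  forall a b1 b2 : L, (b1 `&` b2 <= a)%O ->
    exists c1 c2 : L, [/\ (b1 <= c1)%O, (b2 <= c2)%O & a = (c1 `&` c2)%O].

Section Lattice.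
Context {d : Order.disp_t} {D : latticeType d}.
Implicit Types (u v : D) (J : set D).

Definition lattice_ideal J : Prop :=
  [/\ J !=set0,
      forall u v, J v -> (u <= v)%O -> J u
    & forall u v, J u -> J v -> J (u `|` v)%O].

Definition prime_lattice_ideal J : Prop :=
  [/\ lattice_ideal J, J <> setT
    & forall u v, J (u `&` v)%O -> J u \/ J v].

End Lattice.

Section DistributiveEnvelope.
Context {d : Order.disp_t} (L : meetSemilatticeType d).

Record Pr := PrimeFilter {
  filter_of_Pr :> set L;
  PrP : prime_filter filter_of_Pr }.

Definition sigma_set (a : L) : set Pr := [set x : Pr | (x : set L) a].

Definition env_pred : {pred set Pr} :=
  fun U => `[< exists (n : nat) (a : 'I_n.+1 -> L),
                 U = \bigcup_i sigma_set (a i) >].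

Lemma sigma_setI a b : sigma_set (a `&` b)%O = sigma_set a `&` sigma_set b.
Proof.
apply/seteqP; split => [x|x [xa xb]]; rewrite /sigma_set /=.
  case: (PrP x) => -[_ upx _] _ _ xab.
  by split; apply: (upx _ _ xab); [exact: leIl | exact: leIr].
by case: (PrP x) => -[_ _ Ix] _ _; exact: Ix.
Qed.

Lemma env_predP (U : set Pr) :
  reflect (exists2 s : seq L, s != [::] &
             U = [set x : Pr | exists2 a, a \in s & sigma_set a x])
          (U \in env_pred).
Proof.
apply: (iffP (asboolP _)) => [[n [a ->]]|[[//|a0 s] _ ->]].
  exists (codom a).
    by rewrite -size_eq0 size_codom card_ord.
  apply/seteqP; split => [x [i _ xi]|x [_ /codomP[i ->] xi]].
    by exists (a i) => //; exact: codom_f.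
  by exists i.
exists (size s), (fun i => nth a0 (a0 :: s) i).
apply/seteqP; split => [x [b bs xb]|x [i _ xi]].
  have bi : (index b (a0 :: s) < (size s).+1)%N by rewrite index_mem.
  by exists (Ordinal bi) => //; rewrite [nat_of_ord _]/= nth_index.
by exists (nth a0 (a0 :: s) i) => //; rewrite mem_nth /=.
Qed.

Lemma env_predI : {in env_pred &, forall U V, (U `&` V)%O \in env_pred}.
Proof.
move=> U V /env_predP[s s0 ->] /env_predP[t t0 ->]; apply/env_predP.
exists [seq Order.meet a b | a <- s, b <- t].
  by rewrite -size_eq0 size_allpairs muln_eq0 !size_eq0 negb_or s0.
rewrite meetEset; apply/seteqP; split => [x [[a sa xa] [b tb xb]]|x [c]].
  by exists (a `&` b)%O; [exact: allpairs_f | rewrite sigma_setI].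
move=> /allpairsP[[a b] /= [sa tb ->]]; rewrite sigma_setI => -[xa xb].
by split; [exists a | exists b].
Qed.

Lemma env_predU : {in env_pred &, forall U V, (U `|` V)%O \in env_pred}.
Proof.
move=> U V /env_predP[s s0 ->] /env_predP[t _ ->]; apply/env_predP.
exists (s ++ t); first by case: s s0.
rewrite joinEset; apply/seteqP; split => [x [|] [a sa xa]|x [a]].
- by exists a => //; rewrite mem_cat sa.
- by exists a => //; rewrite mem_cat sa orbT.
- by rewrite mem_cat => /orP[sa|ta] xa; [left | right]; exists a.
Qed.

Lemma sigma_in_env a : sigma_set a \in env_pred.
Proof.
apply/asboolP; exists 0, (fun=> a).
by apply/seteqP; split => [x xa|x [_ _ //]]; exists ord0.
Qed.

Record envelope := Envelope {
  envelope_set :> set Pr;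
  envelope_setP : envelope_set \in env_pred }.

Definition sigma (a : L) : envelope := Envelope (sigma_in_env a).

End DistributiveEnvelope.

HB.instance Definition _ d (L : meetSemilatticeType d) :=
  [isSub for @envelope_set d L].
HB.instance Definition _ d (L : meetSemilatticeType d) :=
  [Choice of @envelope d L by <:].

Fact envelope_display : Order.disp_t. Proof. exact: Order.Disp tt tt. Qed.

HB.instance Definition _ d (L : meetSemilatticeType d) :=
  Order.SubChoice_isSubLattice.Build _ _ _ envelope_display (@envelope d L)
    (@env_predI d L) (@env_predU d L).

Lemma envelope_leE d (L : meetSemilatticeType d) (U V : envelope L) :
  (U <= V)%O <-> envelope_set U `<=` envelope_set V.
Proof. by rewrite -Order.le_val; split => /subsetPset. Qed.

Lemma envelope_meetE d (L : meetSemilatticeType d) (U V : envelope L) :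
  envelope_set (U `&` V)%O = envelope_set U `&` envelope_set V.
Proof. by []. Qed.

Lemma envelope_joinE d (L : meetSemilatticeType d) (U V : envelope L) :
  envelope_set (U `|` V)%O = envelope_set U `|` envelope_set V.
Proof. by []. Qed.

(* Main.v *)
Require Import Defs.
From mathcomp Require Import all_boot all_order.
From mathcomp Require Import boolp classical_sets.
Local Open Scope classical_set_scope.

(** By Zorn, if [c] is not below [b] some filter is maximal among those
    containing [c] and avoiding [b]; distributivity makes it prime. So [sigma]
    is an order embedding, while primeness extended to finite families of
    principal filters shows that [sigma c] is covered by the [sigma (a i)] as
    soon as every common upper bound of the [a i] is above [c]. Hence the Frink
    closure condition is the trace on [L] of closure under finite joins in the
    envelope, and a Frink ideal is the trace of the ideal it generates there. *)

Import Order.TTheory.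

Section PrimeFilters.
Context {d : Order.disp_t} {L : meetSemilatticeType d}.
Implicit Types (a b c f g : L) (F : set L) (s : seq L).

Lemma meet_filter_up a : meet_filter (up a).
Proof.
split=> [|x y ax xy|x y ax ay]; first by exists a; rewrite /up /=.
  exact: le_trans ax xy.
by rewrite /up /= lexI; apply/andP.
Qed.

(** When [F] is a filter, this is the smallest filter containing both [F] and [f]. *)
Definition adjoin F f : set L := [set y | exists2 g, F g & (g `&` f <= y)%O].

Lemma meet_filter_adjoin F f : meet_filter F -> meet_filter (adjoin F f).
Proof.
move=> [[g Fg] upF mF]; split=> [|x y [h Fh hx] xy|x y [h Fh hx] [k Fk ky]].
- by exists g, g => //; exact: leIl.
- by exists h => //; exact: le_trans hx xy.
- exists (h `&` k)%O; first exact: mF.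
  by rewrite lexI (le_trans _ hx) ?(le_trans _ ky) // leI2 ?leIl ?leIr.
Qed.

Lemma exists_maximal_filter {c b} : ~~ (c <= b)%O ->
  exists F, [/\ meet_filter F, F c, ~ F b &
    forall G, meet_filter G -> F `<=` G -> ~ G b -> G `<=` F].
Proof.
move=> ncb.
(* [set0] is allowed so that the empty chain has an upper bound. *)
pose P F := F = set0 \/ [/\ meet_filter F, F c & ~ F b].
have PF F : P F -> F !=set0 -> [/\ meet_filter F, F c & ~ F b].
  by case=> // -> [].
have [F [PFF maxF]] : exists F, P F /\ forall G, F `<` G -> ~ P G.
  apply: Zorn_bigcup => C CP totC.
  have [[x [F0 CF0 F0x]]|/nonemptyPn] := pselect (\bigcup_(X in C) X !=set0);
    last by left.
  have CPF X y : C X -> X y -> [/\ meet_filter X, X c & ~ X b].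
    by move=> /CP PX Xy; apply: PF => //; exists y.
  right; split.
  - split; first by exists x, F0.
      move=> y z [X CX Xy] yz; exists X => //.
      by have [[_ upX _] _ _] := CPF _ _ CX Xy; exact: upX Xy yz.
    move=> y z [X CX Xy] [Y CY Yz].
    have [XY|YX] := totC _ _ CX CY.
      exists Y => //; have [[_ _ IY] _ _] := CPF _ _ CY Yz.
      by apply: IY => //; exact: XY.
    exists X => //; have [[_ _ IX] _ _] := CPF _ _ CX Xy.
    by apply: IX => //; exact: YX.
  - by exists F0 => //; have [] := CPF _ _ CF0 F0x.
  - by move=> [X CX Xb]; have [_ _] := CPF _ _ CX Xb.
have ltF G : F `<=` G -> ~ G `<=` F -> F `<` G by move=> FG GF; split.
have [fF Fc Fb] : [/\ meet_filter F, F c & ~ F b].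
  (* A maximal [F] cannot be empty: [up c] contains [c] and avoids [b], so it would properly extend
     it. *)
  case: PFF => // F0; exfalso; apply: (maxF (up c)).
    by apply: ltF; rewrite F0 // => /(_ c); apply; rewrite /up /=.
  by right; split; [exact: meet_filter_up | rewrite /up /= | exact/negP].
exists F; split=> // G fG FG Gb; apply: contrapT => /(ltF _ FG) /maxF; apply.
by right; split=> //; exact: FG.
Qed.

Lemma prime_filter_separation c b : distributive_meet_semilattice L ->
  ~~ (c <= b)%O -> exists F, [/\ prime_filter F, F c & ~ F b].
Proof.
move=> distrL ncb; have [F [fF Fc Fb maxF]] := exists_maximal_filter ncb.
have [_ upF mF] := fF.
(* By maximality, adjoining to [F] an element outside it produces a filter that contains [b]. *)
have avoid f : ~ F f -> exists2 g, F g & (g `&` f <= b)%O.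
  move=> Ff; apply: contrapT => nb; apply: Ff.
  apply: (maxF (adjoin F f)) => //; first exact: meet_filter_adjoin.
    by move=> g Fg; exists g => //; exact: leIl.
  by exists c => //; exact: leIr.
exists F; split=> //; split=> // [FT|F1 F2 [_ up1 _] [_ up2 _] F12].
  by apply: Fb; rewrite FT.
apply: contrapT => /not_orP[/existsNP[f1 /not_implyP[F1f1 /avoid[g1 Fg1 gf1]]]].
move=> /existsNP[f2 /not_implyP[F2f2 /avoid[g2 Fg2 gf2]]].
(* Splitting [b], then its factor above [f1], yields a factor [e2] above both
   [f1] and [f2], hence in [F1 `&` F2]. *)
have [c1 [c2 [gc1 fc2 bE]]] := distrL _ _ _ gf1.
have gf2c : (g2 `&` f2 <= c2)%O by rewrite (le_trans gf2) // bE leIr.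
have [e1 [e2 [ge1 fe2 c2E]]] := distrL _ _ _ gf2c.
apply: Fb; rewrite bE; apply: (mF); first exact: (upF _ _ Fg1).
rewrite c2E; apply: (mF); first exact: (upF _ _ Fg2).
apply: F12; split; last exact: up2 fe2.
by apply: up1 F1f1 _; rewrite (le_trans fc2) // c2E leIr.
Qed.

(** Induction on [s], with primeness applied to [up a] and the filter [G] of common upper bounds of
    the tail. *)
Lemma prime_filter_bigcap_up F s : prime_filter F -> s != [::] ->
  (forall b, {in s, forall a, (a <= b)%O} -> F b) -> exists2 a, a \in s & F a.
Proof.
move=> [_ _ pF]; elim: s => // a s IH _ sF.
have [s0|s0] := eqVneq s [::].
  exists a; rewrite ?mem_head //; apply: sF => b.
  by rewrite s0 inE => /eqP ->.
pose G : set L := [set b | {in s, forall a, (a <= b)%O}].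
(* Without a common upper bound of the tail, [G] is no filter, but the induction hypothesis then
   applies vacuously. *)
have [G0|/nonemptyPn G0] := pselect (G !=set0); last first.
  have [|e es Fe] := IH s0; first by move=> b Gb; have : G b by []; rewrite G0.
  by exists e => //; rewrite inE es orbT.
have fG : meet_filter G.
  split=> // [x y Gx xy e es|x y Gx Gy e es]; first exact: le_trans (Gx _ es) xy.
  by rewrite lexI Gx // Gy.
have [|/(_ a) aF|GF] := pF _ _ (meet_filter_up a) fG.
- move=> b [ab Gb]; apply: sF => e; rewrite inE => /orP[/eqP -> //|].
  exact: Gb.
- by exists a; rewrite ?mem_head //; apply: aF; rewrite /up /=.
- have [|e es Fe] := IH s0; first by move=> b /GF.
  by exists e => //; rewrite inE es orbT.
Qed.

Lemma frink_ideal_seq I s c : frink_ideal I -> s != [::] ->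
  {in s, forall a, I a} ->
  (forall b, {in s, forall a, (a <= b)%O} -> (c <= b)%O) -> I c.
Proof.
case: s => // a0 s [_ frI] _ sI sc.
apply: (frI (size s) (fun i => nth a0 (a0 :: s) i)) => [i|b ub].
  by apply: sI; rewrite mem_nth.
apply: sc => a /(nthP a0)[i ilt <-].
exact: (ub (Ordinal ilt)).
Qed.

End PrimeFilters.

Section Envelope.
Context {d : Order.disp_t} {L : meetSemilatticeType d}.
Implicit Types (a b c : L) (s : seq L) (I : set L) (U V : envelope L).
Implicit Types J : set (envelope L).

Lemma le_of_sigma_subset a b : distributive_meet_semilattice L ->
  sigma_set a `<=` sigma_set b -> (a <= b)%O.
Proof.
move=> distrL ab; apply: contrapT => /negP.
move=> /(prime_filter_separation _ _ distrL)[F [pF Fa]]; apply.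
exact: (ab (PrimeFilter pF)).
Qed.

Lemma sigmaI a b : sigma (a `&` b)%O = (sigma a `&` sigma b)%O.
Proof. by apply: val_inj; rewrite /= sigma_setI. Qed.

(** The sequence [s] may be empty, so this set need not belong to the envelope. *)
Definition cover s : set (Pr L) :=
  [set x : Pr L | exists2 a, a \in s & sigma_set a x].

Lemma sigma_le_of_cover {s a U} : envelope_set U = cover s -> a \in s ->
  (sigma a <= U)%O.
Proof. by move=> Us sa; apply/envelope_leE => x xa; rewrite Us; exists a. Qed.

Lemma lattice_ideal_cover {J U s} : lattice_ideal J -> s != [::] ->
  envelope_set U `<=` cover s -> {in s, forall a, J (sigma a)} -> J U.
Proof.
move=> [_ dJ jJ]; elim: s U => // a s IH U _ Us sJ.
have Ja : J (sigma a) by apply: sJ; rewrite mem_head.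
(* The induction bottoms out at a singleton, as an empty cover may have no counterpart in the
   envelope to join with. *)
have [s0|s0] := eqVneq s [::].
  apply: dJ Ja _; apply/envelope_leE => x /Us[e].
  by rewrite s0 inE => /eqP ->.
have Vs : cover s \in @env_pred d L.
  by apply/env_predP; exists s.
apply: (dJ _ (sigma a `|` Envelope Vs)%O).
  apply: jJ => //; apply: IH => // e es.
  by apply: sJ; rewrite inE es orbT.
apply/envelope_leE; rewrite envelope_joinE => x /Us[e].
rewrite inE => /orP[/eqP ->|es] xe; first by left.
by right; exists e.
Qed.

Lemma frink_ideal_preimage J : lattice_ideal J -> frink_ideal (@sigma d L @^-1` J).
Proof.
move=> iJ; have [[U JU] dJ _] := iJ; split.
  have /env_predP[[//|a s] _ Us] := envelope_setP U.
  by exists a; apply: dJ JU _; apply: (sigma_le_of_cover Us); rewrite mem_head.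
move=> n a c aJ ac; apply: (@lattice_ideal_cover _ _ (codom a)) => //.
- by rewrite -size_eq0 size_codom card_ord.
(* A point containing [c] contains every common upper bound of the [a i], hence some [a i] by
   primeness. *)
- move=> x xc; apply: prime_filter_bigcap_up; first exact: PrP.
    by rewrite -size_eq0 size_codom card_ord.
  move=> b ub; have [[_ upx _] _ _] := PrP x; apply: upx xc _.
  by apply: ac => i _; apply: ub; exact: codom_f.
- by move=> _ /codomP[i ->]; exact: aJ.
Qed.

(** For nonempty [I], the lattice ideal generated by the image of [I] under [sigma]. *)
Definition ideal_of I : set (envelope L) :=
  [set U | exists2 s, {in s, forall a, I a} & envelope_set U `<=` cover s].

Lemma lattice_ideal_ideal_of I : I !=set0 -> lattice_ideal (ideal_of I).
Proof.
move=> [a Ia]; split.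
- exists (sigma a), [:: a] => [e|x xa]; first by rewrite inE => /eqP ->.
  by exists a; rewrite ?mem_head.
- move=> U V [s sI Vs] /envelope_leE UV; exists s => //.
  exact: subset_trans Vs.
- move=> U V [s sI Us] [t tI Vt]; exists (s ++ t) => [e|].
    by rewrite mem_cat => /orP[/sI|/tI].
  rewrite envelope_joinE => x [/Us[e es xe]|/Vt[e et xe]]; exists e => //.
    by rewrite mem_cat es.
  by rewrite mem_cat et orbT.
Qed.

Lemma preimage_ideal_of I : distributive_meet_semilattice L ->
  frink_ideal I -> I = @sigma d L @^-1` ideal_of I.
Proof.
move=> distrL frI; apply/seteqP; split=> [a Ia|c [s sI cs]].
  exists [:: a] => [e|x xa]; first by rewrite inE => /eqP ->.
  by exists a; rewrite ?mem_head.
(* [s] may be empty, which happens only if [c] is a bottom element. *)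
have [[a0 Ia0] _] := frI.
apply: (@frink_ideal_seq _ _ I (a0 :: s)) => // [a|b ub].
  by rewrite inE => /orP[/eqP -> //|/sI].
(* A point containing [c] contains some [a] in [s], hence also the upper bound [b]; the order
   embedding then puts [c] below [b]. *)
apply: le_of_sigma_subset => // x /cs[a sa xa].
have [[_ upx _] _ _] := PrP x; apply: upx xa _.
by apply: ub; rewrite inE sa orbT.
Qed.

Lemma prime_ideal_of I : distributive_meet_semilattice L ->
  prime_frink_ideal I -> prime_lattice_ideal (ideal_of I).
Proof.
move=> distrL [frI IT pI]; have IE := preimage_ideal_of _ distrL frI.
have iJ : lattice_ideal (ideal_of I).
  by case: frI => I0 _; exact: lattice_ideal_ideal_of.
have [_ dJ _] := iJ; split=> // [JT|U V UV].
  by apply: IT; rewrite IE JT preimage_setT.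
(* If all generators of [W] were in [I], they would cover [W] and place it in the ideal. This
   reduces primeness to a meet of two elements of [L]. *)
have generator W : ~ ideal_of I W -> exists2 a, ~ I a & (sigma a <= W)%O.
  move=> nW; have /env_predP[s s0 Ws] := envelope_setP W.
  apply: contrapT => na; apply: nW; exists s => [a sa|]; last by rewrite Ws.
  apply: contrapT => nIa; apply: na; exists a => //.
  exact: sigma_le_of_cover Ws sa.
apply: contrapT => /not_orP[/generator[a nIa aU] /generator[b nIb bV]].
have : I (a `&` b)%O.
  by rewrite IE /preimage /= sigmaI; apply: dJ UV _; exact: leI2.
by move=> /pI[].
Qed.

Lemma prime_frink_ideal_preimage J : prime_lattice_ideal J ->
  prime_frink_ideal (@sigma d L @^-1` J).
Proof.
move=> [iJ JT pJ]; split; first exact: frink_ideal_preimage.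
  (* An ideal containing every [sigma a] contains all their finite unions, which exhaust the
     envelope. *)
  move=> IT; apply: JT; apply/seteqP; split=> // U _.
  have /env_predP[s s0 Us] := envelope_setP U.
  apply: (lattice_ideal_cover iJ s0) => [|a _]; first by rewrite Us.
  by have : (@sigma d L @^-1` J) a by rewrite IT.
by move=> a b; rewrite /preimage /= sigmaI => /pJ.
Qed.

End Envelope.

Theorem theorem4p13 (d : Order.disp_t) (L : meetSemilatticeType d)
    (distrL : distributive_meet_semilattice L) :
  (forall I : set L,
     frink_ideal I <->
     exists J : set (envelope L), lattice_ideal J /\ I = @sigma d L @^-1` J) /\
  (forall I : set L,
     prime_frink_ideal I <->
     exists J : set (envelope L),
       prime_lattice_ideal J /\ I = @sigma d L @^-1` J).
Proof.
split=> I; split.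
- move=> frI; exists (ideal_of I); split; last exact: preimage_ideal_of.
  by case: frI => I0 _; exact: lattice_ideal_ideal_of.
- by move=> [J [iJ ->]]; exact: frink_ideal_preimage.
- move=> pI; exists (ideal_of I); split; first exact: prime_ideal_of.
  by case: pI => frI _ _; exact: preimage_ideal_of.
- by move=> [J [pJ ->]]; exact: prime_frink_ideal_preimage.
Qed.
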